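(* Let $S$ be a protocol sketch, $X_0$ a completion of $S$, and $r$ a safety violation of $X_0$. Then $\pi_{\mathit{safe}}(r)$ is optimal with respect to $r$ and $S$; that is, for every completion $X$ of $S$, $X$ satisfies $\pi_{\mathit{safe}}(r)$ if and only if $r$ is not a run of $X$.
   Context: Protocols and sketches. Fix a finite instance: parameters are assigned fixed values. A state is an assignment of values to a finite set of state variables. A protocol consists of an initial-state predicate Init and a finite set of actions; each action $A$ may have a vector of arguments $\vec v$ ranging over a domain, and each action instance $A(\vec v)$ is a predicate on pairs of states $(s,t)$ of the form (pre-condition on $s$) $\wedge$ (post-condition), the post-condition being a conjunction of post-clauses, one per state variable. We write $s \xrightarrow{A(\vec v)} t$ if $(s,t)$ satisfies $A(\vec v)$; $A(\vec v)$ is enabled at $s$ if its pre-condition holds at $s$. A protocol sketch $S$ is such a protocol in which some sub-expressions are replaced by holes. Each hole $h$ has a list of arguments (drawn from parameters, state variables, and the arguments of its action), an output type and a grammar, and occurs exactly once, in exactly one action $A_h$. A hole is a pre-hole (boolean-valued, a placeholder for a pre-condition of $A_h$) or a post-hole (the right-hand side of a post-clause $x' = h(\ldots)$ for a state variable $x$). No holes occur in Init. A completion $X$ of $S$ assigns to each hole $h_i$ an interpretation $\widehat h_i^X$ (an expression from its grammar, viewed as a function of its arguments), yielding a protocol. For a state $s$, an action instance $A(\vec v)$ and a hole $h_i$ of $A$, $s^\star$ denotes $s$ together with $\vec v$, restricted to the arguments of $h_i$. A safety violation of $X_0$ is a finite action-annotated run $r = s_0 \xrightarrow{A_1(\vec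 v_1)} s_1 \cdots \xrightarrow{A_k(\vec v_k)} s_k$ of $X_0$. $r$ is a run of a completion $X$ if $s_0$ satisfies Init and each annotated transition is a transition of $X$ by the annotated action instance. Pruning constraints. A term is a triple $(h, s^\star, y)$ (hole, assignment to its arguments, output value); a completion $X$ satisfies it iff $\widehat h^X(s^\star) \ne y$. A pruning constraint is a disjunction of terms, satisfied by $X$ iff some term is. $\pi_{\mathit{safe}}(r)$ is the disjunction of the terms $\tau_{A(\vec v),i} := (h_i, s^\star, \widehat h_i^{X_0}(s^\star))$ over all transitions $s \xrightarrow{A(\vec v)} t$ of $r$ and all holes $h_i$ of $A$. A pruning constraint $\pi$ is under-pruning w.r.t. $r$ and $S$ if some completion $X$ of $S$ satisfies $\pi$ and has $r$ as a run; over-pruning if some completion $X$ does not satisfy $\pi$ and does not have $r$ as a run; optimal if neither. *)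

(* Defs.v *)
From Stdlib Require List.
From mathcomp Require Import all_boot.

Set Implicit Arguments.
Unset Strict Implicit.
Unset Printing Implicit Defensive.

(* A finite instance: the values of the parameters are fixed once and for all.
   Value domains may be arbitrary types. *)
Record instance : Type := Instance {
  param : finType;
  param_type : param -> Type;
  param_val : forall p : param, param_type p;
  var : finType;
  var_type : var -> Type;
  action : finType;
  arity : action -> nat;
  arg_type : forall A : action, 'I_(arity A) -> Type
}.

Definition state (I : instance) : Type := forall x : var I, var_type x.

Definition arg_vector (I : instance) (A : action I) : Type :=
  forall j : 'I_(arity A), arg_type j.

(* [pre] and [post] may refer to the parameters, whose values are fixed in the
   instance.  [post A x] is the post-clause of the state variable [x]: a
   predicate on the source state, the action arguments and the target state. *)
Record protocol (I : instance) : Type := Protocol {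
  init : state I -> Prop;
  pre : forall A : action I, state I -> arg_vector A -> Prop;
  post : forall (A : action I) (x : var I),
    state I -> arg_vector A -> state I -> Prop
}.

Arguments pre {I} P {A} s v : rename.
Arguments post {I} P {A} x s v t : rename.

Definition transition (I : instance) (P : protocol I) (A : action I)
    (v : arg_vector A) (s t : state I) : Prop :=
  pre P s v /\ forall x : var I, post P x s v t.

Arguments transition {I} P {A} v s t.

Record step (I : instance) : Type := Step {
  step_action : action I;
  step_args : arg_vector step_action;
  step_target : state I
}.

Arguments step_args {I} e : rename.

Record annotated_seq (I : instance) : Type := AnnotatedSeq {
  start : state I;
  steps : seq (step I)
}.

Record annotated_transition (I : instance) : Type := AnnotatedTransition {
  at_source : state I;
  at_action : action I;
  at_args : arg_vector at_action;
  at_target : state I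
}.

Arguments at_args {I} d : rename.

Fixpoint transitions_from (I : instance) (s : state I) (l : seq (step I)) :
    seq (annotated_transition I) :=
  if l is e :: l' then
    AnnotatedTransition s (step_args e) (step_target e)
      :: transitions_from (step_target e) l'
  else [::].

Definition transitions (I : instance) (r : annotated_seq I) :
    seq (annotated_transition I) :=
  transitions_from (start r) (steps r).

Definition is_run (I : instance) (P : protocol I) (r : annotated_seq I) : Prop :=
  init P (start r) /\
  List.Forall
    (fun d => transition P (at_args d) (at_source d) (at_target d))
    (transitions r).

(* What an argument of a hole of action [A] can be. *)
Inductive hole_arg (I : instance) (A : action I) : Type :=
| ParamArg of param I
| VarArg of var I
| ActionArg of 'I_(arity A).

Definition hole_arg_type (I : instance) (A : action I) (a : hole_arg A) : Type :=
  match a with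
  | ParamArg p => param_type p
  | VarArg x => var_type x
  | ActionArg j => arg_type j
  end.

Definition hole_arg_val (I : instance) (A : action I) (s : state I)
    (v : arg_vector A) (a : hole_arg A) : hole_arg_type a :=
  match a with
  | ParamArg p => param_val p
  | VarArg x => s x
  | ActionArg j => v j
  end.

Definition assignment (I : instance) (A : action I) (l : seq (hole_arg A)) : Type :=
  forall k : 'I_(size l), hole_arg_type (tnth (in_tuple l) k).

(* The assignment s*: [s] together with [v], restricted to the arguments [l]. *)
Definition restrict (I : instance) (A : action I) (l : seq (hole_arg A))
    (s : state I) (v : arg_vector A) : assignment l :=
  fun k => hole_arg_val s v (tnth (in_tuple l) k).

Arguments restrict {I A} l s v.

(* [PostHole x] is the right-hand side of the post-clause x' = h(...). *)
Inductive hole_kind (I : instance) : Type :=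
| PreHole
| PostHole of var I.

Arguments PreHole {I}.

Definition hole_out (I : instance) (k : hole_kind I) : Type :=
  match k with
  | PreHole => bool
  | PostHole x => var_type x
  end.

(* Holes are indexed by the action in which they occur.  The pre-condition of
   an action is the conjunction of [known_pre] and of its pre-holes; the
   post-clause of [x] is either x' = h(...), for the unique post-hole h of
   kind [PostHole x] if there is one, or the hole-free clause [known_post],
   which is otherwise ignored.  [expr h] are the expressions over the arguments
   of [h] with the output type of [h], and [grammar h] those generated by the
   grammar of [h]. *)
Record sketch (I : instance) : Type := Sketch {
  sketch_init : state I -> Prop;
  known_pre : forall A : action I, state I -> arg_vector A -> Prop;
  known_post : forall (A : action I) (x : var I),
    state I -> arg_vector A -> state I -> Prop;
  hole : action I -> finType;
  kind : forall A : action I, hole A -> hole_kind I;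
  hole_args : forall A : action I, hole A -> seq (hole_arg A);
  expr : forall A : action I, hole A -> Type;
  eval : forall (A : action I) (h : hole A),
    expr h -> assignment (hole_args h) -> hole_out (kind h);
  grammar : forall (A : action I) (h : hole A), expr h -> Prop;
  post_hole_unique : forall (A : action I) (x : var I) (h1 h2 : hole A),
    kind h1 = PostHole x -> kind h2 = PostHole x -> h1 = h2
}.

Arguments hole {I} S A : rename.
Arguments kind {I S A} h : rename.
Arguments hole_args {I S A} h : rename.
Arguments known_pre {I} S {A} s v : rename.
Arguments known_post {I} S {A} x s v t : rename.

Record completion (I : instance) (S : sketch I) : Type := Completion {
  choice : forall (A : action I) (h : hole S A), expr h;
  choice_in_grammar : forall (A : action I) (h : hole S A), grammar (choice h)
}.

Arguments choice {I S} X {A} h : rename.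

Definition interp (I : instance) (S : sketch I) (X : completion S)
    (A : action I) (h : hole S A) :
    assignment (hole_args h) -> hole_out (kind h) :=
  eval (choice X h).

Arguments interp {I S} X {A} h.

(* [interp_at X h s v] is the value of [h] under [X] at s*. *)
Definition interp_at (I : instance) (S : sketch I) (X : completion S)
    (A : action I) (h : hole S A) (s : state I) (v : arg_vector A) :
    hole_out (kind h) :=
  interp X h (restrict (hole_args h) s v).

Arguments interp_at {I S} X {A} h s v.

(* The conjunct [y] if the hole is a pre-hole; no constraint otherwise. *)
Definition pre_conjunct (I : instance) (k : hole_kind I) : hole_out k -> Prop :=
  match k with
  | PreHole => fun y => y = true
  | PostHole _ => fun _ => True
  end.

(* The clause x' = y if the hole is a post-hole for a variable x; no constraint
   otherwise. *)
Definition post_equation (I : instance) (t : state I) (k : hole_kind I) :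
    hole_out k -> Prop :=
  match k with
  | PreHole => fun _ => True
  | PostHole x => fun y => t x = y
  end.

Definition complete (I : instance) (S : sketch I) (X : completion S) :
    protocol I :=
  {| init := sketch_init S;
     pre := fun A s v =>
       known_pre S s v /\
       forall h : hole S A, pre_conjunct (interp_at X h s v);
     post := fun A x s v t =>
       (forall h : hole S A, kind h = PostHole x ->
          post_equation t (interp_at X h s v)) /\
       ((forall h : hole S A, kind h <> PostHole x) ->
          known_post S x s v t) |}.

Definition safety_violation (I : instance) (S : sketch I) (X : completion S)
    (r : annotated_seq I) : Prop :=
  is_run (complete X) r.

Record term (I : instance) (S : sketch I) : Type := Term {
  term_action : action I;
  term_hole : hole S term_action;
  term_input : assignment (hole_args term_hole);
  term_output : hole_out (kind term_hole)
}.

Arguments term_input {I S} tau : rename.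

Definition satisfies_term (I : instance) (S : sketch I) (X : completion S)
    (tau : term S) : Prop :=
  interp X (term_hole tau) (term_input tau) <> term_output tau.

(* A list of terms, read as their disjunction. *)
Definition pruning_constraint (I : instance) (S : sketch I) : Type :=
  seq (term S).

Definition satisfies (I : instance) (S : sketch I) (X : completion S)
    (pi : pruning_constraint S) : Prop :=
  List.Exists (satisfies_term X) pi.

Definition safe_term (I : instance) (S : sketch I) (X0 : completion S)
    (A : action I) (h : hole S A) (s : state I) (v : arg_vector A) : term S :=
  Term (restrict (hole_args h) s v) (interp_at X0 h s v).

Definition pi_safe (I : instance) (S : sketch I) (X0 : completion S)
    (r : annotated_seq I) : pruning_constraint S :=
  flatten [seq [seq safe_term X0 h (at_source d) (at_args d)
                 | h <- enum (hole S (at_action d))]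
            | d <- transitions r].

Definition under_pruning (I : instance) (S : sketch I) (r : annotated_seq I)
    (pi : pruning_constraint S) : Prop :=
  exists X : completion S, satisfies X pi /\ is_run (complete X) r.

Definition over_pruning (I : instance) (S : sketch I) (r : annotated_seq I)
    (pi : pruning_constraint S) : Prop :=
  exists X : completion S, ~ satisfies X pi /\ ~ is_run (complete X) r.

Definition optimal (I : instance) (S : sketch I) (r : annotated_seq I)
    (pi : pruning_constraint S) : Prop :=
  ~ under_pruning r pi /\ ~ over_pruning r pi.

(* Main.v *)
Require Import Defs.
From Stdlib Require Import Classical.
From Stdlib Require List.
From mathcomp Require Import all_boot.

(** Fix a transition of [X0] from [s] to [t].  A completion [X] has the same
    annotated transition iff it gives every hole of the action the value that
    [X0] gives it at s*: a pre-hole must evaluate to [true] under both, and a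
    post-hole for [x] must evaluate to [t x] under both.  Hence [r] is a run of
    [X] iff [X] falsifies every term of the pruning constraint. *)

Lemma Exists_map (T : eqType) (U : Type) (P : U -> Prop) (f : T -> U)
    (s : seq T) :
  List.Exists P [seq f x | x <- s] <-> exists2 x, x \in s & P (f x).
Proof.
elim: s => [|y s IHs] /=; first by rewrite List.Exists_nil; split=> // -[].
rewrite List.Exists_cons IHs; split=> [[Py | [x xs Px]] | [x]].
- by exists y; rewrite // mem_head.
- by exists x; rewrite // in_cons xs orbT.
- by rewrite in_cons => /orP[/eqP-> | xs Px]; [left | right; exists x].
Qed.

(** Regroups the flat disjunction by transition, so that it can be compared with a run one
    transition at a time. *)
Lemma satisfies_pi_safe (I : instance) (S : sketch I) (X0 X : completion S)
    (r : annotated_seq I) :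
  satisfies X (pi_safe X0 r) <->
  List.Exists
    (fun d => exists h : hole S (at_action d),
       interp_at X h (at_source d) (at_args d) <>
       interp_at X0 h (at_source d) (at_args d))
    (transitions r).
Proof.
rewrite /satisfies /pi_safe; elim: (transitions r) => [|d l IHl] /=.
  by rewrite !List.Exists_nil.
rewrite List.Exists_app List.Exists_cons IHl Exists_map.
split=> -[[h] | ?]; try by right.
  by left; exists h.
by left; exists h; rewrite ?mem_enum.
Qed.

(** Stated for a variable kind [k], so that case analysis on [k] also refines the type of [y1] and
    [y2]. *)
Lemma hole_out_unique (I : instance) (t : state I) (k : hole_kind I)
    (y1 y2 : hole_out k) :
  pre_conjunct y1 -> pre_conjunct y2 ->
  (forall x, k = PostHole x -> post_equation t y1) ->
  (forall x, k = PostHole x -> post_equation t y2) ->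
  y1 = y2.
Proof.
case: k y1 y2 => [|x] y1 y2 /=; first by move=> -> ->.
by move=> _ _ /(_ x erefl) <- /(_ x erefl) <-.
Qed.

Lemma transition_complete_eq (I : instance) (S : sketch I)
    (X0 X : completion S) (A : action I) (v : arg_vector A) (s t : state I) :
  transition (complete X0) v s t ->
  transition (complete X) v s t <->
  forall h : hole S A, interp_at X h s v = interp_at X0 h s v.
Proof.
case=> /= -[known0 pre0] post0; split=> [[/= [_ preX] postX] h | eqX].
  apply: (@hole_out_unique _ t) => // x kx.
  - exact: (postX x).1.
  - exact: (post0 x).1.
(* [known_pre] and [known_post] do not depend on the completion, so they carry over from [X0]; only
   hole values are rewritten. *)
split=> /=; first by split=> // h; rewrite eqX.
move=> x; have [holes0 known_x] := post0 x; split=> // h kx.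
by rewrite eqX; exact: holes0.
Qed.

Arguments transition_complete_eq {I S X0} X {A v s t}.

Lemma satisfies_pi_safe_not_run (I : instance) (S : sketch I)
    (X0 X : completion S) (r : annotated_seq I) :
  safety_violation X0 r ->
  satisfies X (pi_safe X0 r) <-> ~ is_run (complete X) r.
Proof.
case=> init_r run0; rewrite satisfies_pi_safe.
move: run0; rewrite !List.Forall_forall => run0.
split=> [/List.Exists_exists [d [dr [h neq]]] [_] | nrun].
  rewrite List.Forall_forall => /(_ d dr).
  by move/(transition_complete_eq X (run0 d dr)).
(* All completions share [sketch_init], so only the transitions remain. *)
apply: NNPP => nsat; apply: nrun; split=> //.
apply/List.Forall_forall => d dr.
apply/(transition_complete_eq X (run0 d dr)) => h.
(* Output types are arbitrary, so equality of hole values need not be decidable; hence the classical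
   step. *)
apply: NNPP => neq; apply: nsat; apply/List.Exists_exists.
by exists d; split=> //; exists h.
Qed.

Theorem theorem2 (I : instance) (S : sketch I) (X0 : completion S)
    (r : annotated_seq I) (hr : safety_violation X0 r) :
  optimal r (pi_safe X0 r) /\
  (forall X : completion S,
     satisfies X (pi_safe X0 r) <-> ~ is_run (complete X) r).
Proof.
have sat X := @satisfies_pi_safe_not_run I S X0 X r hr.
(* Each direction of [sat] refutes one defect: the forward one under-pruning, the backward one
   over-pruning. *)
by split=> //; split=> -[X [satX runX]]; [exact: (sat X).1 | exact/satX/sat].
Qed.
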